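(* Let $n=m+s$ with $m,s\ge1$, $q=\operatorname{col}(q_a,q_u)$, $\mathbf{p}=\operatorname{col}(\mathbf{p}_a,\mathbf{p}_u)$ with $q_a,\mathbf{p}_a\in\mathbb{R}^m$ and $q_u,\mathbf{p}_u\in\mathbb{R}^s$, and consider the mechanical system $$\dot q=\nabla_{\mathbf{p}}\tilde H,\qquad \dot{\mathbf{p}}=-\nabla_q\tilde H+\tilde G(q_u)v,\qquad \tilde H(q,\mathbf{p})=\tfrac12\mathbf{p}^\top\tilde M^{-1}(q_u)\mathbf{p}+V_u(q_u),$$ $$\tilde M(q_u)=\begin{bmatrix}I_m&0\\0&m_{uu}(q_u)\end{bmatrix},\qquad \tilde G(q_u)=\begin{bmatrix}I_m\\-m_{au}^\top(q_u)\end{bmatrix},$$ where $m_{uu}(q_u)\in\mathbb{R}^{s\times s}$ is symmetric positive definite and $m_{au}(q_u)\in\mathbb{R}^{m\times s}$. Let $q_\star\in\mathbb{R}^n$. Assume: (A5) For every $i\in\{1,\dots,m\}$ the $i$-th row of $m_{au}$, viewed as a vector field on $\mathbb{R}^s$, has symmetric Jacobian; equivalently, there is a function $V_N:\mathbb{R}^s\to\mathbb{R}^m$ with $\dot V_N=-m_{au}(q_u)\dot q_u$, i.e. with Jacobian $\nabla V_N(q_u)=-m_{au}(q_u)$. (A6) There are constants $k_e,k_a,k_u\in\mathbb{R}$ and symmetric positive semidefinite $K_k,K_I\in\mathbb{R}^{m\times m}$ such that (a) $K(q_u):=k_eI_m+k_aK_k+k_uK_km_{au}m_{uu}^{-1}m_{au}^\top$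 is invertible for all $q_u\in\mathbb{R}^s$; (b) the matrix $$M_d^{-1}(q_u):=\begin{bmatrix}k_ek_aI_m+k_a^2K_k&-k_ak_uK_km_{au}m_{uu}^{-1}\\-k_ak_um_{uu}^{-1}m_{au}^\top K_k&k_ek_um_{uu}^{-1}+k_u^2m_{uu}^{-1}m_{au}^\top K_km_{au}m_{uu}^{-1}\end{bmatrix}$$ is positive definite, and the function $$V_d(q):=k_ek_uV_u(q_u)+\tfrac12\left(k_aq_a+k_uV_N(q_u)\right)^\top K_I\left(k_aq_a+k_uV_N(q_u)\right)$$ satisfies $q_\star=\arg\min V_d(q)$, the minimum being isolated. Let $K_P\in\mathbb{R}^{m\times m}$ be symmetric positive definite. Then the control law $$\begin{aligned}v(q,\mathbf{p})=&-K^{-1}\Big[k_uK_km_{au}m_{uu}^{-1}\nabla_{q_u}V_u+K_I(k_aq_a+k_uV_N)+\tfrac{k_u}{2}K_km_{au}m_{uu}^{-1}\nabla_{q_u}^\top[m_{uu}^{-1}\mathbf{p}_u]\,\mathbf{p}_u\\&\quad-k_uK_k\nabla_{q_u}[m_{au}m_{uu}^{-1}\mathbf{p}_u]\,m_{uu}^{-1}\mathbf{p}_u\Big]-K_PK^\top\left(k_a\mathbf{p}_a-k_um_{au}m_{uu}^{-1}\mathbf{p}_u\right)\end{aligned}$$ is a SIDA--PBC with generalised forces for this system, with $H_d(q,\mathbf{p})=\tfrac12\mathbf{p}^\top M_d^{-1}(q_u)\mathbf{p}+V_d(q)$ and $$\begin{aligned}\Lambda(q,\mathbf{p})=\tfrac12M_d\Big[&-M_d^{-1}\nabla_q^\top[\tilde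 M^{-1}\mathbf{p}]+\tilde M^{-1}\nabla_q^\top[M_d^{-1}\mathbf{p}]\\&-M_d^{-1}\tilde GK^{-1}\big[\,0_{m\times m}\ \big|\ k_uK_km_{au}m_{uu}^{-1}\nabla_{q_u}^\top[m_{uu}^{-1}\mathbf{p}_u]-2k_uK_k\nabla_{q_u}[m_{au}m_{uu}^{-1}\mathbf{p}_u]m_{uu}^{-1}\,\big]\Big]M_d-\tilde GK_P\tilde G^\top.\end{aligned}$$
   Context: All functions are assumed smooth. For scalar $f$, $\nabla_x f$ is the column gradient. For a vector-valued map $g$, $\nabla_x[g]$ is its Jacobian matrix (rows are transposed gradients of the components) and $\nabla_x^\top[g]$ is the transpose of that Jacobian; in expressions such as $\nabla_q[A(q)\mathbf{p}]$ the momentum $\mathbf{p}$ is held fixed. Definition. A state feedback $v(q,\mathbf{p})$ for a mechanical system $\dot q=\nabla_{\mathbf{p}}\tilde H$, $\dot{\mathbf{p}}=-\nabla_q\tilde H+\tilde G v$ with $\tilde H=\frac12\mathbf{p}^\top\tilde M^{-1}(q)\mathbf{p}+V(q)$ is a SIDA--PBC (simultaneous interconnection and damping assignment passivity-based control) with generalised forces, with data $H_d$ and $\Lambda$, if for all $(q,\mathbf{p})$ $$-\nabla_q\tilde H(q,\mathbf{p})+\tilde G(q)v(q,\mathbf{p})=-M_d(q)\tilde M^{-1}(q)\nabla_qH_d(q,\mathbf{p})+\Lambda(q,\mathbf{p})M_d^{-1}(q)\mathbf{p},$$ where $H_d(q,\mathbf{p})=\frac12\mathbf{p}^\top M_d^{-1}(q)\mathbf{p}+V_d(q)$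 with $M_d$ symmetric positive definite, $q_\star=\arg\min V_d(q)$, and $$\mathbf{p}^\top M_d^{-1}(q)\Lambda(q,\mathbf{p})M_d^{-1}(q)\mathbf{p}\le0\quad\text{for all }(q,\mathbf{p}).$$ *)

(* Defs.v *)
From HB Require Import structures.
From mathcomp Require Import all_boot all_order all_algebra.
From mathcomp Require Import all_classical all_reals all_analysis.

Set Implicit Arguments.
Unset Strict Implicit.
Unset Printing Implicit Defensive.

Import Order.TTheory GRing.Theory Num.Theory.
Import numFieldNormedType.Exports.

Local Open Scope classical_set_scope.
Local Open Scope ring_scope.

(* Between the finite-dimensional spaces used here, [Ck k] is the usual class
   of k times continuously differentiable maps. *)
Fixpoint Ck (R : realType) (V W : normedModType R) (k : nat) (f : V -> W) :
    Prop :=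
  if k is k'.+1 then
    (forall x, differentiable f x) /\ (forall u, Ck k' ('D_u f))
  else continuous f.

Definition smooth (R : realType) (V W : normedModType R) (f : V -> W) : Prop :=
  forall k, Ck k f.

Definition grad (R : realType) (n : nat) (f : 'cV[R]_n -> R) (x : 'cV[R]_n) :
    'cV[R]_n :=
  \col_(j < n) 'D_(delta_mx j 0) f x.

(* The library's [jacobian] acts on row vectors from the right, so it is the
   transpose of the matrix below: here the rows are the transposed gradients
   of the components. *)
Definition jac (R : realType) (n m : nat) (g : 'cV[R]_n -> 'cV[R]_m)
    (x : 'cV[R]_n) : 'M[R]_(m, n) :=
  \matrix_(i < m) (grad (fun y => g y i 0) x)^T.

Definition quadf (R : realType) (n : nat) (A : 'M[R]_n) (x : 'cV[R]_n) : R :=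
  (x^T *m A *m x) 0 0.

Definition symmx (R : realType) (n : nat) (A : 'M[R]_n) : Prop := A^T = A.

Definition sympos (R : realType) (n : nat) (A : 'M[R]_n) : Prop :=
  symmx A /\ (forall x, x != 0 -> 0 < quadf A x).

Definition sympossemi (R : realType) (n : nat) (A : 'M[R]_n) : Prop :=
  symmx A /\ (forall x, 0 <= quadf A x).

(* A global minimizer; it need not be the only one, isolatedness being a separate
   requirement. *)
Definition is_argmin (R : realType) (n : nat) (f : 'cV[R]_n -> R)
    (x : 'cV[R]_n) : Prop :=
  forall y, f x <= f y.

Definition is_isolated_min (R : realType) (n : nat) (f : 'cV[R]_n -> R)
    (x : 'cV[R]_n) : Prop :=
  \forall y \near x, y != x -> f x < f y.

Definition hamiltonian (R : realType) (n : nat) (M : 'cV[R]_n -> 'M[R]_n)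
    (V : 'cV[R]_n -> R) (q p : 'cV[R]_n) : R :=
  2^-1 * quadf (invmx (M q)) p + V q.

(* The system q' = grad_p H, p' = - grad_q H + G(q) v with
   H = hamiltonian mass potential. *)
Record mech_system (R : realType) (n m : nat) := MechSystem {
  mass : 'cV[R]_n -> 'M[R]_n;
  potential : 'cV[R]_n -> R;
  input : 'cV[R]_n -> 'M[R]_(n, m)
}.

(* The energy Hd of the data (Hd, Lambda) is given by its mass matrix [Md] and
   potential [Vd]: Hd = hamiltonian Md Vd.  The smoothness clauses express that
   all functions involved are smooth, in q or jointly in (q, p). *)
Definition is_SIDA_PBC (R : realType) (n m : nat) (S : mech_system R n m)
    (qstar : 'cV[R]_n) (v : 'cV[R]_n -> 'cV[R]_n -> 'cV[R]_m)
    (Md : 'cV[R]_n -> 'M[R]_n) (Vd : 'cV[R]_n -> R)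
    (Lambda : 'cV[R]_n -> 'cV[R]_n -> 'M[R]_n) : Prop :=
  let H := hamiltonian (mass S) (potential S) in
  let Hd := hamiltonian Md Vd in
  [/\ [/\ smooth (fun x : 'cV[R]_n * 'cV[R]_n => v x.1 x.2),
          smooth Md,
          smooth Vd &
          smooth (fun x : 'cV[R]_n * 'cV[R]_n => Lambda x.1 x.2)],
      forall q, sympos (Md q),
      is_argmin Vd qstar,
      forall q p,
        - grad (fun q' => H q' p) q + input S q *m v q p =
        - (Md q *m invmx (mass S q) *m grad (fun q' => Hd q' p) q)
        + Lambda q p *m invmx (Md q) *m p
    & forall q p,
        quadf (invmx (Md q) *m Lambda q p *m invmx (Md q)) p <= 0].

Definition rows_jacobian_symmetric (R : realType) (m s : nat)
    (mau : 'cV[R]_s -> 'M[R]_(m, s)) : Prop :=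
  forall (i : 'I_m) (qu : 'cV[R]_s),
    symmx (jac (fun y => (row i (mau y))^T) qu).

Section ControlLaw.

(* q = col_mx qa qu and p = col_mx pa pu live in 'cV_(m + s), so that
   qa = usubmx q, qu = dsubmx q, and likewise for p. *)
Context (R : realType) (m s : nat).
Context (muu : 'cV[R]_s -> 'M[R]_s) (mau : 'cV[R]_s -> 'M[R]_(m, s)).
Context (Vu : 'cV[R]_s -> R) (VN : 'cV[R]_s -> 'cV[R]_m).
Context (ke ka ku : R) (Kk KI KP : 'M[R]_m).

Implicit Types (q p : 'cV[R]_(m + s)) (qu : 'cV[R]_s).

Definition Mtilde q : 'M[R]_(m + s) :=
  block_mx 1%:M 0 0 (muu (dsubmx q)).

Definition Gtilde q : 'M[R]_(m + s, m) :=
  col_mx 1%:M (- (mau (dsubmx q))^T).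

Definition pfl_system : mech_system R (m + s) m :=
  MechSystem Mtilde (fun q => Vu (dsubmx q)) Gtilde.

Definition Kmx qu : 'M[R]_m :=
  ke%:M + ka *: Kk
  + ku *: (Kk *m mau qu *m invmx (muu qu) *m (mau qu)^T).

(* The matrix written M_d^{-1}; the mass matrix M_d itself is its inverse. *)
Definition Mdinv qu : 'M[R]_(m + s) :=
  let iM := invmx (muu qu) in
  block_mx
    ((ke * ka)%:M + ka ^+ 2 *: Kk)
    (- ((ka * ku) *: (Kk *m mau qu *m iM)))
    (- ((ka * ku) *: (iM *m (mau qu)^T *m Kk)))
    ((ke * ku) *: iM
     + ku ^+ 2 *: (iM *m (mau qu)^T *m Kk *m mau qu *m iM)).

Definition Mdes q : 'M[R]_(m + s) := invmx (Mdinv (dsubmx q)).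

Definition Vdes q : R :=
  ke * ku * Vu (dsubmx q)
  + 2^-1 * quadf KI (ka *: usubmx q + ku *: VN (dsubmx q)).

(* The Jacobians in qu of muu^-1 pu and of mau muu^-1 pu, with pu fixed. *)
Definition Jv qu (pu : 'cV[R]_s) : 'M[R]_s :=
  jac (fun y => invmx (muu y) *m pu) qu.

Definition Jav qu (pu : 'cV[R]_s) : 'M[R]_(m, s) :=
  jac (fun y => mau y *m invmx (muu y) *m pu) qu.

Definition control q p : 'cV[R]_m :=
  let qa := usubmx q in let qu := dsubmx q in
  let pa := usubmx p in let pu := dsubmx p in
  let A := mau qu in let iM := invmx (muu qu) in
  - (invmx (Kmx qu) *m
      (ku *: (Kk *m A *m iM *m grad Vu qu)
       + KI *m (ka *: qa + ku *: VN qu)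
       + (ku / 2) *: (Kk *m A *m iM *m (Jv qu pu)^T *m pu)
       - ku *: (Kk *m Jav qu pu *m iM *m pu)))
  - KP *m (Kmx qu)^T *m (ka *: pa - ku *: (A *m iM *m pu)).

Definition Lambda q p : 'M[R]_(m + s) :=
  let qu := dsubmx q in let pu := dsubmx p in
  let A := mau qu in let iM := invmx (muu qu) in
  let iMd := Mdinv qu in
  let iMt := invmx (Mtilde q) in
  let G := Gtilde q in
  let B : 'M[R]_(m, m + s) :=
    row_mx 0 (ku *: (Kk *m A *m iM *m (Jv qu pu)^T)
              - (2 * ku) *: (Kk *m Jav qu pu *m iM)) in
  2^-1 *: (Mdes q *m
    (- (iMd *m (jac (fun q' => invmx (Mtilde q') *m p) q)^T)
     + iMt *m (jac (fun q' => Mdinv (dsubmx q') *m p) q)^T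
     - iMd *m G *m invmx (Kmx qu) *m B) *m Mdes q)
  - G *m KP *m G^T.

End ControlLaw.

(* Main.v *)
(* Write W = muu^-1, z = ka qa + ku VN and Gamma = [ka I; - ku W mau^T].
   Since Md is invertible, the momentum equation may be multiplied by Md^-1.
   The identity Md^-1 G = Gamma K then cancels K^-1, the terms quadratic in p
   agree by the choice of Lambda, and what remains is an identity between
   grad Vu and KI z, where jac VN = - mau enters through grad Vd.  For the
   dissipation inequality, the part of Lambda other than - G KP G^T does no
   work: once all Jacobians are expressed through those of W pu and mau W pu,
   the terms cancel up to transposition of scalars, which leaves minus the
   KP-quadratic form at K^T Gamma^T p. *)
Require Import Defs.
From HB Require Import structures.
From mathcomp Require Import all_boot all_order all_algebra.
From mathcomp Require Import all_classical all_reals all_analysis.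
From mathcomp Require Import ring.

Set Implicit Arguments.
Unset Strict Implicit.
Unset Printing Implicit Defensive.

Import Order.TTheory GRing.Theory Num.Theory.
Import numFieldNormedType.Exports.

Local Open Scope classical_set_scope.
Local Open Scope ring_scope.

(** * Smooth maps between normed spaces: closure under sums, products, inverses and linear maps *)

Lemma CkW (R : realType) (V W : normedModType R) k (f : V -> W) :
  Ck k.+1 f -> Ck k f.
Proof.
elim: k f => [|k IH] f [df dfk].
  by move=> x; exact/differentiable_continuous/df.
by split=> // u; exact/IH/dfk.
Qed.

Lemma smooth_differentiable (R : realType) (V W : normedModType R)
  (f : V -> W) : smooth f -> forall x, differentiable f x.
Proof. by move=> sf; have [] := sf 1%N. Qed.

Lemma smooth_derivable (R : realType) (V W : normedModType R)
  (f : V -> W) : smooth f -> forall x u, derivable f x u.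
Proof. by move=> /smooth_differentiable df x u; exact/diff_derivable. Qed.

Lemma smooth_derive (R : realType) (V W : normedModType R) (f : V -> W) u :
  smooth f -> smooth ('D_u f).
Proof. by move=> sf k; have [_] := sf k.+1; exact. Qed.

Lemma smooth_cst (R : realType) (V W : normedModType R) (a : W) :
  smooth (fun=> a : W) (V := V).
Proof.
move=> k; elim: k a => [|k IH] a; first by move=> x; exact: cvg_cst.
split=> [x|u]; first exact: differentiable_cst.
rewrite (_ : 'D_u _ = fun=> 0) //; apply/funext => x.
exact: (derive_cst a).
Qed.

Lemma Ck_add (R : realType) (V W : normedModType R) k (f g : V -> W) :
  Ck k f -> Ck k g -> Ck k (fun x => f x + g x).
Proof.
elim: k f g => [|k IH] f g; first by move=> cf cg x;
  apply: continuousD; [exact: cf|exact: cg].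
move=> [df Df] [dg Dg]; split=> [x|u]; first exact: differentiableD.
rewrite (_ : 'D_u _ = fun x => 'D_u f x + 'D_u g x).
  by apply: IH; [exact: Df|exact: Dg].
by apply/funext => x; apply: deriveD; exact: diff_derivable.
Qed.

Lemma smoothD (R : realType) (V W : normedModType R) (f g : V -> W) :
  smooth f -> smooth g -> smooth (fun x => f x + g x).
Proof. by move=> sf sg k; exact: Ck_add. Qed.

Lemma derive_comp_linear (R : realType) (U V W : normedModType R)
    (L : {linear U -> V}) (f : V -> W) x u :
  continuous L -> differentiable f (L x) ->
  'D_u (f \o L) x = 'D_(L u) f (L x).
Proof.
move=> cL df; have dL := linear_differentiable x cL.
rewrite deriveE; last exact: differentiable_comp.
by rewrite diff_comp //= diff_lin // deriveE.
Qed.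

Lemma derive_linear_comp (R : realType) (U V W : normedModType R)
    (L : {linear V -> W}) (f : U -> V) x u :
  continuous L -> differentiable f x ->
  'D_u (L \o f) x = L ('D_u f x).
Proof.
move=> cL df; have dL := linear_differentiable (f x) cL.
rewrite deriveE; last exact: differentiable_comp.
by rewrite diff_comp //= diff_lin // deriveE.
Qed.

(** The derivative of [f \o L] along [u] is ['D_(L u) f \o L], again a map composed with [L]. The
    induction on the order therefore closes without a higher-order chain rule; the direction must
    stay general because it changes from [u] to [L u]. *)
Lemma smooth_comp_linear (R : realType) (U V W : normedModType R)
    (L : {linear U -> V}) (f : V -> W) :
  continuous L -> smooth f -> smooth (f \o L).
Proof.
move=> cL sf k; move: {sf}(sf k); elim: k f => [|k IH] f.
  by move=> cf x; apply: continuous_comp; [exact: cL|exact: cf].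
move=> [df Df]; split=> [x|u].
  by apply: differentiable_comp => //; exact: linear_differentiable.
rewrite (_ : 'D_u _ = 'D_(L u) f \o L); first exact/IH/Df.
by apply/funext => x; exact: derive_comp_linear.
Qed.

Lemma smooth_linear_comp (R : realType) (U V W : normedModType R)
    (L : {linear V -> W}) (f : U -> V) :
  continuous L -> smooth f -> smooth (L \o f).
Proof.
move=> cL sf k; move: {sf}(sf k); elim: k f => [|k IH] f.
  by move=> cf x; apply: continuous_comp; [exact: cf|exact: cL].
move=> [df Df]; split=> [x|u].
  by apply: differentiable_comp => //; exact: linear_differentiable.
rewrite (_ : 'D_u _ = L \o 'D_u f); first exact/IH/Df.
by apply/funext => x; exact: derive_linear_comp.
Qed.

Lemma smooth_id (R : realType) (V : normedModType R) : smooth (@id V).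
Proof.
case=> [|k]; first by move=> x.
split=> [x|u]; first by apply: (@linear_differentiable _ _ _ idfun) => ?;
  exact: cvg_id.
rewrite (_ : 'D_u _ = fun=> u); first exact: smooth_cst.
by apply/funext => x; exact: derive_id.
Qed.

(** The product rule leaves one factor undifferentiated in each term, so the induction hypothesis
    needs that factor one order below what is given; [CkW] lowers it. *)
Lemma Ck_mul (R : realType) (V : normedModType R) k (f g : V -> R) :
  Ck k f -> Ck k g -> Ck k (fun x => f x * g x).
Proof.
elim: k f g => [|k IH] f g; first by move=> cf cg x;
  apply: continuousM; [exact: cf|exact: cg].
move=> Cf Cg; move: (Cf) (Cg) => [df Df] [dg Dg]; split=> [x|u].
  exact: differentiableM.
rewrite (_ : 'D_u _ = fun x => f x * 'D_u g x + g x * 'D_u f x).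
  apply: Ck_add; apply: IH => //.
  - exact: CkW.
  - exact: Dg.
  - exact: CkW.
  - exact: Df.
by apply/funext => x; apply: deriveM; apply: diff_derivable.
Qed.

Lemma smoothM (R : realType) (V : normedModType R) (f g : V -> R) :
  smooth f -> smooth g -> smooth (fun x => f x * g x).
Proof. by move=> sf sg k; exact: Ck_mul. Qed.

(** The derivative of [1/f] is a polynomial in [1/f] and a derivative of [f]. Regularity of [1/f] at
    order [k] thus yields order [k+1], with [f] kept fixed throughout the induction. *)
Lemma smoothV (R : realType) (V : normedModType R) (f : V -> R) :
  (forall x, f x != 0) -> smooth f -> smooth (fun x => (f x)^-1).
Proof.
move=> f0 sf k; elim: k => [|k IH].
  by move=> x; apply: continuousV => //; exact: (sf 0).
split=> [x|u]; first exact/differentiableV/f0/smooth_differentiable.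
rewrite (_ : 'D_u _ = fun x => -1 * ((f x)^-1 * (f x)^-1 * 'D_u f x)).
  apply: Ck_mul; first exact: smooth_cst.
  by apply: Ck_mul; [exact: Ck_mul | exact: smooth_derive].
apply/funext => x; rewrite deriveV //; last exact: smooth_derivable.
by rewrite mulN1r -invfM -expr2 scaleNr.
Qed.

Lemma smooth_sum (R : realType) (V W : normedModType R) (I : Type)
    (r : seq I) (P : pred I) (f : I -> V -> W) :
  (forall i, P i -> smooth (f i)) ->
  smooth (fun x => \sum_(i <- r | P i) f i x).
Proof.
move=> sf; elim: r => [|i r IH].
  by under eq_fun do rewrite big_nil; exact: smooth_cst.
under eq_fun do rewrite big_cons.
by case Pi: (P i) => //; apply: smoothD => //; exact: sf.
Qed.

Lemma smooth_prod (R : realType) (V : normedModType R) (I : Type)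
    (r : seq I) (P : pred I) (f : I -> V -> R) :
  (forall i, P i -> smooth (f i)) ->
  smooth (fun x => \prod_(i <- r | P i) f i x).
Proof.
move=> sf; elim: r => [|i r IH].
  by under eq_fun do rewrite big_nil; exact: smooth_cst.
under eq_fun do rewrite big_cons.
by case Pi: (P i) => //; apply: smoothM => //; exact: sf.
Qed.

Lemma smoothN (R : realType) (V W : normedModType R) (f : V -> W) :
  smooth f -> smooth (fun x => - f x).
Proof. exact/(smooth_linear_comp (L := -%R))/opp_continuous. Qed.

Lemma smoothZ (R : realType) (V W : normedModType R) (a : R) (f : V -> W) :
  smooth f -> smooth (fun x => a *: f x).
Proof. exact/(smooth_linear_comp (L := *:%R a))/scaler_continuous. Qed.

(** * Smoothness of matrix-valued maps *)

Lemma smooth_coord (R : realType) (V : normedModType R) (m n : nat)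
    (f : V -> 'M[R]_(m, n)) i j :
  smooth f -> smooth (fun x => f x i j).
Proof.
pose c (N : 'M[R]_(m, n)) : R := N i j.
have lin : linear c by move=> a A B; rewrite /c !mxE.
pose linM := GRing.isLinear.Build _ _ _ _ _ lin.
pose L : {linear 'M[R]_(m, n) -> R} := HB.pack c linM.
exact/(smooth_linear_comp (L := L))/coord_continuous.
Qed.

(** Expansion in elementary matrices presents [f] as a finite sum of scalar functions times constant
    matrices, which reduces matrix calculus to the scalar case. *)
Lemma smooth_mx (R : realType) (V : normedModType R) (m n : nat)
    (f : V -> 'M[R]_(m, n)) :
  (forall i j, smooth (fun x => f x i j)) -> smooth f.
Proof.
move=> sf.
rewrite (_ : f = fun x => \sum_i \sum_j f x i j *: delta_mx i j); last first.
  by apply/funext => x; exact: matrix_sum_delta.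
do 2![apply: smooth_sum => ? _].
set A := delta_mx _ _.
pose c (a : R) := a *: A.
have lin : linear c by move=> a b d; rewrite /c scalerDl scalerA.
pose linM := GRing.isLinear.Build _ _ _ _ _ lin.
pose L : {linear R -> 'M[R]_(m, n)} := HB.pack c linM.
exact/(smooth_linear_comp (L := L))/sf/scalel_continuous.
Qed.

Lemma smooth_mulmx (R : realType) (V : normedModType R) (m n p : nat)
    (f : V -> 'M[R]_(m, n)) (g : V -> 'M[R]_(n, p)) :
  smooth f -> smooth g -> smooth (fun x => f x *m g x).
Proof.
move=> sf sg; apply: smooth_mx => i j; under eq_fun do rewrite mxE.
by apply: smooth_sum => k _; apply: smoothM; exact: smooth_coord.
Qed.

Lemma smooth_trmx (R : realType) (V : normedModType R) (m n : nat)
    (f : V -> 'M[R]_(m, n)) : smooth f -> smooth (fun x => (f x)^T).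
Proof.
by move=> sf; apply: smooth_mx => i j; under eq_fun do rewrite mxE;
  exact: smooth_coord.
Qed.

Lemma smooth_det (R : realType) (V : normedModType R) (n : nat)
    (f : V -> 'M[R]_n) : smooth f -> smooth (fun x => \det (f x)).
Proof.
move=> sf; apply: smooth_sum => s _; apply: smoothM; first exact: smooth_cst.
by apply: smooth_prod => i _; exact: smooth_coord.
Qed.

(** Cramer's rule: each entry is a cofactor divided by the determinant. Since [invmx] is defined by
    cases, invertibility at every point is what selects the adjugate formula uniformly in [x]. *)
Lemma smooth_invmx (R : realType) (V : normedModType R) (n : nat)
    (f : V -> 'M[R]_n) : (forall x, f x \in unitmx) -> smooth f ->
  smooth (fun x => invmx (f x)).
Proof.
move=> fu sf; apply: smooth_mx => i j.
under eq_fun => x do rewrite /invmx fu 2!mxE.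
apply: smoothM.
  apply: smoothV; last exact: smooth_det.
  by move=> x; rewrite -unitfE -unitmxE.
apply: smoothM; first exact: smooth_cst.
apply: smooth_det; apply: smooth_mx => k l; under eq_fun do rewrite !mxE.
exact: smooth_coord.
Qed.

Lemma smooth_col_mx (R : realType) (V : normedModType R) (m1 m2 n : nat)
    (f : V -> 'M[R]_(m1, n)) (g : V -> 'M[R]_(m2, n)) :
  smooth f -> smooth g -> smooth (fun x => col_mx (f x) (g x)).
Proof.
move=> sf sg; apply: smooth_mx => i j; rewrite /col_mx.
by under eq_fun do rewrite mxE; case: (fintype.split i) => k;
  exact: smooth_coord.
Qed.

Lemma smooth_row_mx (R : realType) (V : normedModType R) (m n1 n2 : nat)
    (f : V -> 'M[R]_(m, n1)) (g : V -> 'M[R]_(m, n2)) :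
  smooth f -> smooth g -> smooth (fun x => row_mx (f x) (g x)).
Proof.
move=> sf sg; apply: smooth_mx => i j; rewrite /row_mx.
by under eq_fun do rewrite mxE; case: (fintype.split j) => k;
  exact: smooth_coord.
Qed.

Lemma smooth_block_mx (R : realType) (V : normedModType R)
    (m1 m2 n1 n2 : nat) (a : V -> 'M[R]_(m1, n1)) (b : V -> 'M[R]_(m1, n2))
    (c : V -> 'M[R]_(m2, n1)) (d : V -> 'M[R]_(m2, n2)) :
  smooth a -> smooth b -> smooth c -> smooth d ->
  smooth (fun x => block_mx (a x) (b x) (c x) (d x)).
Proof.
by move=> sa sb sc sd; apply: smooth_col_mx; apply: smooth_row_mx.
Qed.

Lemma dsubmx_continuous (R : realType) (m1 m2 n : nat) :
  continuous (dsubmx : 'M[R]_(m1 + m2, n) -> 'M[R]_(m2, n)).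
Proof.
move=> u A /nbhs_ballP[e /= e0 eA].
apply/nbhs_ballP; exists e => //= v [_ uv]; apply: eA; split => // i j.
by rewrite !mxE; exact: uv.
Qed.

Lemma usubmx_continuous (R : realType) (m1 m2 n : nat) :
  continuous (usubmx : 'M[R]_(m1 + m2, n) -> 'M[R]_(m1, n)).
Proof.
move=> u A /nbhs_ballP[e /= e0 eA].
apply/nbhs_ballP; exists e => //= v [_ uv]; apply: eA; split => // i j.
by rewrite !mxE; exact: uv.
Qed.

Lemma smooth_snd (R : realType) (V W : normedModType R) :
  smooth (snd : V * W -> W).
Proof.
apply: (smooth_comp_linear (L := snd)) (@smooth_id R W) => x.
exact: cvg_snd.
Qed.

(** * Product rules for matrices, Jacobians and gradients *)

Lemma derive_coord (R : realType) (V : normedModType R) (m n : nat)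
    (f : V -> 'M[R]_(m, n)) x u i j :
  derivable f x u -> 'D_u (fun y => f y i j) x = ('D_u f x) i j.
Proof. by move=> df; rewrite derive_mx // mxE. Qed.

Lemma derive_mulmx (R : realType) (V : normedModType R) (m n p : nat)
    (f : V -> 'M[R]_(m, n)) (g : V -> 'M[R]_(n, p)) x u :
  smooth f -> smooth g ->
  'D_u (fun y => f y *m g y) x = 'D_u f x *m g x + f x *m 'D_u g x.
Proof.
move=> sf sg; apply/matrixP => i j.
rewrite -derive_coord; last exact/smooth_derivable/smooth_mulmx.
rewrite (_ : (fun y => _) = \sum_k (fun y => f y i k * g y k j)); last first.
  by apply/funext => y; rewrite mxE fct_sumE.
have sfc k : smooth (fun y => f y i k) by exact: smooth_coord.
have sgc k : smooth (fun y => g y k j) by exact: smooth_coord.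
rewrite derive_sum => [|k]; last exact/smooth_derivable/smoothM.
rewrite !mxE -big_split /=; apply: eq_bigr => k _.
rewrite deriveM ?derive_coord; try exact: smooth_derivable.
by rewrite [LHS]addrC; congr (_ + _); rewrite /GRing.scale /= mulrC.
Qed.

Lemma derive_trmx (R : realType) (V : normedModType R) (m n : nat)
    (f : V -> 'M[R]_(m, n)) x u :
  smooth f -> 'D_u (fun y => (f y)^T) x = ('D_u f x)^T.
Proof.
move=> sf; apply/matrixP => i j; rewrite mxE.
rewrite -!derive_coord; try exact/smooth_derivable; last first.
  exact/smooth_derivable/smooth_trmx.
by under eq_fun do rewrite mxE.
Qed.

Lemma jacE (R : realType) (n m : nat) (g : 'cV[R]_n -> 'cV[R]_m) x i j :
  smooth g -> jac g x i j = ('D_(delta_mx j 0) g x) i 0.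
Proof. by move=> sg; rewrite !mxE derive_coord //; exact: smooth_derivable. Qed.

Lemma jacD (R : realType) (n m : nat) (f g : 'cV[R]_n -> 'cV[R]_m) x :
  smooth f -> smooth g -> jac (fun y => f y + g y) x = jac f x + jac g x.
Proof.
move=> sf sg; apply/matrixP => i j.
rewrite [RHS]mxE !jacE //; last exact: smoothD.
by rewrite deriveD ?mxE //; exact: smooth_derivable.
Qed.

Lemma jac_mulmxl (R : realType) (n m p : nat) (A : 'M[R]_(p, m))
    (g : 'cV[R]_n -> 'cV[R]_m) x :
  smooth g -> jac (fun y => A *m g y) x = A *m jac g x.
Proof.
move=> sg; have sA := smooth_cst 'cV[R]_n A.
apply/matrixP => i j; rewrite jacE; last exact: smooth_mulmx.
rewrite derive_mulmx // derive_cst mul0mx add0r [LHS]mxE [RHS]mxE.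
by apply: eq_bigr => k _; rewrite jacE.
Qed.

(** The vector [P x] is frozen while differentiating in [y], yet joint smoothness in [x] is wanted.
    Column [j] of the Jacobian is the [j]-th partial derivative of [F] at [L x] applied to [P x], a
    product of two smooth maps of [x]. *)
Lemma smooth_jac (R : realType) (n m k : nat) (V : normedModType R)
    (F : 'cV[R]_n -> 'M[R]_(m, k)) (P : V -> 'cV[R]_k)
    (L : {linear V -> 'cV[R]_n}) :
  continuous L -> smooth F -> smooth P ->
  smooth (fun x => jac (fun y => F y *m P x) (L x)).
Proof.
move=> cL sF sP; apply: smooth_mx => i j.
rewrite (_ : (fun x => _) =
    fun x => (('D_(delta_mx j 0) F \o L) x *m P x) i 0); last first.
  apply/funext => x; have sc := smooth_cst 'cV[R]_n (P x).
  rewrite jacE; last exact: smooth_mulmx.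
  by rewrite derive_mulmx // derive_cst mulmx0 addr0.
apply/smooth_coord/smooth_mulmx => //.
exact/smooth_comp_linear/smooth_derive.
Qed.

Lemma smooth_grad (R : realType) (n : nat) (f : 'cV[R]_n -> R) :
  smooth f -> smooth (grad f).
Proof.
move=> sf; apply: smooth_mx => i j.
by under eq_fun do rewrite mxE; exact: smooth_derive.
Qed.

Lemma gradD (R : realType) (n : nat) (f g : 'cV[R]_n -> R) x :
  smooth f -> smooth g -> grad (fun y => f y + g y) x = grad f x + grad g x.
Proof.
move=> sf sg; apply/colP => i; rewrite !mxE deriveD //; exact: smooth_derivable.
Qed.

Lemma gradZ (R : realType) (n : nat) (a : R) (f : 'cV[R]_n -> R) x :
  smooth f -> grad (fun y => a * f y) x = a *: grad f x.
Proof.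
by move=> sf; apply/colP => i; rewrite !mxE deriveZ //; exact: smooth_derivable.
Qed.

Lemma grad_dot (R : realType) (n m : nat) (f g : 'cV[R]_n -> 'cV[R]_m) x :
  smooth f -> smooth g ->
  grad (fun y => ((f y)^T *m g y) 0 0) x =
  (jac f x)^T *m g x + (jac g x)^T *m f x.
Proof.
move=> sf sg; apply/colP => i; have sfT := smooth_trmx sf.
rewrite mxE derive_coord; last exact/smooth_derivable/smooth_mulmx.
rewrite derive_mulmx // derive_trmx // !mxE; congr (_ + _).
  by apply: eq_bigr => k _; rewrite [in RHS]mxE jacE // mxE.
by apply: eq_bigr => k _; rewrite [in RHS]mxE jacE // mxE mulrC.
Qed.

Lemma grad_dotl (R : realType) (n m : nat) (c : 'cV[R]_m)
    (g : 'cV[R]_n -> 'cV[R]_m) x :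
  smooth g -> grad (fun y => (c^T *m g y) 0 0) x = (jac g x)^T *m c.
Proof.
move=> sg; rewrite (grad_dot x (smooth_cst _ c) sg).
rewrite [X in X^T *m _](_ : _ = 0) ?trmx0 ?mul0mx ?add0r //.
by apply/matrixP => i j; rewrite jacE ?derive_cst ?mxE //; exact: smooth_cst.
Qed.

(** The form is linear in its matrix, so with [p] fixed it is the pairing of the constant [p] with
    the vector [F y *m p]. This converts the transposed Jacobians in [Lambda] into gradients of
    kinetic energies. *)
Lemma grad_quadf_mx (R : realType) (n m : nat) (F : 'cV[R]_n -> 'M[R]_m) p x :
  smooth F ->
  grad (fun y => quadf (F y) p) x = (jac (fun y => F y *m p) x)^T *m p.
Proof.
move=> sF; rewrite -grad_dotl; last exact/smooth_mulmx/smooth_cst.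
by congr (grad _ x); apply/funext => y; rewrite /quadf mulmxA.
Qed.

Lemma grad_quadf (R : realType) (n m : nat) (A : 'M[R]_m)
    (g : 'cV[R]_n -> 'cV[R]_m) x : symmx A -> smooth g ->
  grad (fun y => quadf A (g y)) x = 2 *: ((jac g x)^T *m A *m g x).
Proof.
move=> sA sg; have sAg := smooth_mulmx (smooth_cst 'cV[R]_n A) sg.
under [in LHS]eq_fun do rewrite /quadf -mulmxA.
by rewrite grad_dot // jac_mulmxl // trmx_mul sA mulmxA scaler_nat mulr2n.
Qed.

(** * Block coordinates: functions of [qu] alone and of [qa] alone *)

Lemma dsubmx_delta_l (R : realType) (m s : nat) (j : 'I_m) :
  dsubmx (delta_mx (lshift s j) 0 : 'cV[R]_(m + s)) = 0.
Proof. by apply/colP => i; rewrite !mxE eq_rlshift. Qed.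

Lemma dsubmx_delta_r (R : realType) (m s : nat) (j : 'I_s) :
  dsubmx (delta_mx (rshift m j) 0 : 'cV[R]_(m + s)) = delta_mx j 0.
Proof. by apply/colP => i; rewrite !mxE eq_rshift. Qed.

Lemma usubmx_delta_l (R : realType) (m s : nat) (j : 'I_m) :
  usubmx (delta_mx (lshift s j) 0 : 'cV[R]_(m + s)) = delta_mx j 0.
Proof. by apply/colP => i; rewrite !mxE eq_lshift. Qed.

Lemma usubmx_delta_r (R : realType) (m s : nat) (j : 'I_s) :
  usubmx (delta_mx (rshift m j) 0 : 'cV[R]_(m + s)) = 0.
Proof. by apply/colP => i; rewrite !mxE eq_lrshift. Qed.

Lemma smooth_dsub (R : realType) (m s : nat) (W : normedModType R)
    (f : 'cV[R]_s -> W) :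
  smooth f -> smooth (fun q : 'cV[R]_(m + s) => f (dsubmx q)).
Proof. exact/smooth_comp_linear/(@dsubmx_continuous R m s 1). Qed.

Lemma derive_dsub (R : realType) (m s : nat) (W : normedModType R)
    (f : 'cV[R]_s -> W) (q u : 'cV[R]_(m + s)) :
  smooth f -> 'D_u (fun q => f (dsubmx q)) q = 'D_(dsubmx u) f (dsubmx q).
Proof.
move=> sf; apply: (derive_comp_linear _ (@dsubmx_continuous R m s 1)).
exact: smooth_differentiable.
Qed.

Lemma grad_dsub (R : realType) (m s : nat) (f : 'cV[R]_s -> R)
    (q : 'cV[R]_(m + s)) :
  smooth f -> grad (fun q => f (dsubmx q)) q = col_mx 0 (grad f (dsubmx q)).
Proof.
move=> sf; apply/colP => i; rewrite mxE derive_dsub //.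
case: (split_ordP i) => j ->.
  by rewrite dsubmx_delta_l derive0 col_mxEu mxE.
by rewrite dsubmx_delta_r col_mxEd mxE.
Qed.

Lemma jac_dsub (R : realType) (m s k : nat) (g : 'cV[R]_s -> 'cV[R]_k)
    (q : 'cV[R]_(m + s)) :
  smooth g -> jac (fun q => g (dsubmx q)) q = row_mx 0 (jac g (dsubmx q)).
Proof.
move=> sg; apply/matrixP => i j.
rewrite jacE ?derive_dsub //; last exact: smooth_dsub.
case: (split_ordP j) => l ->.
  by rewrite dsubmx_delta_l derive0 row_mxEl !mxE.
by rewrite dsubmx_delta_r row_mxEr jacE.
Qed.

Lemma smooth_usubmx (R : realType) (m s : nat) :
  smooth (usubmx : 'cV[R]_(m + s) -> 'cV[R]_m).
Proof.
exact: (smooth_comp_linear (@usubmx_continuous R m s 1)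
  (@smooth_id R 'cV[R]_m)).
Qed.

Lemma jac_usubmx (R : realType) (m s : nat) (q : 'cV[R]_(m + s)) :
  jac (usubmx : 'cV[R]_(m + s) -> 'cV[R]_m) q = row_mx 1%:M 0.
Proof.
apply/matrixP => i j; rewrite jacE; last exact: smooth_usubmx.
rewrite (derive_comp_linear (f := id) _ (@usubmx_continuous R m s 1)) //.
rewrite derive_id /=; case: (split_ordP j) => l ->.
  by rewrite usubmx_delta_l row_mxEl !mxE andbT.
by rewrite usubmx_delta_r row_mxEr !mxE.
Qed.

(** * Positive definite matrices *)

Lemma sympos_unitmx (R : realType) (n : nat) (A : 'M[R]_n) :
  sympos A -> A \in unitmx.
Proof.
move=> [_ posA]; rewrite unitmxE unitfE; apply/det0P => -[v v0 vA0].
have vT0 : v^T != 0 by rewrite -(inj_eq (can_inj (@trmxK _ _ _))) trmxK trmx0.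
by have := posA _ vT0; rewrite /quadf trmxK vA0 mul0mx mxE ltxx.
Qed.

(** The form of [A^-1] at [x] equals the form of [A] at [A^-1 x], which is nonzero when [x] is. *)
Lemma sympos_invmx (R : realType) (n : nat) (A : 'M[R]_n) :
  sympos A -> sympos (invmx A).
Proof.
move=> pA; have uA := sympos_unitmx pA; have [sA posA] := pA.
have sV : symmx (invmx A) by rewrite /symmx trmx_inv sA.
split=> // x x0; have : invmx A *m x != 0.
  by apply: contra_neq x0 => h; rewrite -(mulKVmx uA x) h mulmx0.
move=> /posA; rewrite /quadf trmx_mul sV -!mulmxA mulKVmx //.
Qed.

Lemma quadf_ge0 (R : realType) (n : nat) (A : 'M[R]_n) x :
  sympos A -> 0 <= quadf A x.
Proof.
move=> [_ posA]; have [->|/posA/ltW//] := eqVneq x 0.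
by rewrite /quadf mulmx0 mxE.
Qed.

(** * The factor Gamma and tactics for matrix identities and smoothness *)

Definition Gammamx (R : realType) (m s : nat) (W : 'M[R]_s) (A : 'M[R]_(m, s))
    (ka ku : R) : 'M[R]_(m + s, m) :=
  col_mx ka%:M (- (ku *: (W *m A^T))).

(** This is the vector fed back by the damping term of the control law. With [qa' = pa] and
    [qu' = W pu], it is the velocity of [z = ka qa + ku VN] as soon as [jac VN = - mau]. *)
Lemma tr_Gammamx_mul (R : realType) (m s : nat) (W : 'M[R]_s)
    (A : 'M[R]_(m, s)) (ka ku : R) (p : 'cV[R]_(m + s)) : symmx W ->
  (Gammamx W A ka ku)^T *m p = ka *: usubmx p - ku *: (A *m W *m dsubmx p).
Proof.
move=> sW; rewrite -{1}(vsubmxK p) tr_col_mx mul_row_col tr_scalar_mx.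
by rewrite mul_scalar_mx linearN linearZ /= trmx_mul trmxK sW mulNmx scalemxAl.
Qed.

(** Normalises to a sum of scaled, left-associated products. Entrywise, the two sides are then
    linear combinations of the same atoms, and [ring] has only scalar coefficients to compare. *)
Ltac mx_expand :=
  rewrite ?(mulmxDl, mulmxDr, mulmxN, mulNmx, =^~ scalemxAl, =^~ scalemxAr,
    mul_scalar_mx, mul_mx_scalar, scalerDr, scalerN, scalerA, mulmxA, mulmx1,
    mulmx0, mul0mx, opprD, opprK, addr0, add0r).

(** Descends through the syntax of a matrix expression. The leaves are closed by [assumption], so
    proofs record the smoothness of the atoms beforehand. *)
Ltac smooth_mx_ops :=
  repeat first [exact: smooth_cst | assumption | apply: smooth_block_mx
    | apply: smooth_col_mx | apply: smooth_row_mx | apply: smoothD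
    | apply: smoothN | apply: smoothZ | apply: smooth_mulmx
    | apply: smooth_trmx].

(** * Algebraic identities between the inertia matrices, Gamma and K *)

Section Closed_loop.

Context (R : realType) (m s : nat).
Context (muu : 'cV[R]_s -> 'M[R]_s) (mau : 'cV[R]_s -> 'M[R]_(m, s)).
Context (Vu : 'cV[R]_s -> R) (VN : 'cV[R]_s -> 'cV[R]_m).
Context (ke ka ku : R) (Kk KI KP : 'M[R]_m).
Context (muu_smooth : smooth muu).
Context (mau_smooth : smooth mau).
Context (Vu_smooth : smooth Vu).
Context (VN_smooth : smooth VN).
Context (muu_sympos : forall qu, sympos (muu qu)).
Context (jac_VN : forall qu, jac VN qu = - mau qu).
Context (Kk_sym : symmx Kk).
Context (KI_sym : symmx KI).
Context (K_unit : forall qu, Kmx muu mau ke ka ku Kk qu \in unitmx).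
Context (Mdinv_sympos : forall qu, sympos (Mdinv muu mau ke ka ku Kk qu)).

Local Notation W qu := (invmx (muu qu)).
Local Notation A := mau.
Local Notation K := (Kmx muu mau ke ka ku Kk).
Local Notation D := (Mdinv muu mau ke ka ku Kk).
Local Notation Gam qu := (Gammamx (W qu) (A qu) ka ku).

Let muu_unit qu : muu qu \in unitmx.
Proof. exact: sympos_unitmx. Qed.

Let W_sym qu : (W qu)^T = W qu.
Proof. by have [] := sympos_invmx (muu_sympos qu). Qed.

Let W_smooth : smooth (fun qu => W qu).
Proof. exact: smooth_invmx. Qed.

Let D_sym qu : (D qu)^T = D qu.
Proof. by have [] := Mdinv_sympos qu. Qed.

Let D_unit qu : D qu \in unitmx.
Proof. exact: sympos_unitmx. Qed.

Lemma invmx_Mtilde (q : 'cV[R]_(m + s)) :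
  invmx (Mtilde muu q) = block_mx 1%:M 0 0 (W (dsubmx q)).
Proof.
rewrite invmx_block_diag ?invmx1 // /Mtilde unitmxE det_ublock det1 mul1r.
by rewrite -unitmxE.
Qed.

(** Underlying structure: [D = ke diag(ka I, ku W) + Gamma Kk Gamma^T]. The block diagonal factor
    maps [G] to Gamma, and [Gamma^T G = ka I + ku A W A^T]; collecting the two contributions behind
    Gamma gives exactly [K]. *)
Lemma Mdinv_mul_Gtilde (q : 'cV[R]_(m + s)) :
  D (dsubmx q) *m Gtilde mau q = Gam (dsubmx q) *m K (dsubmx q).
Proof.
rewrite /Mdinv /Gtilde /Kmx /Gammamx.
set w := W _; set a := A _.
rewrite mul_block_col mul_col_mx !mulmx1; congr col_mx.
  by mx_expand; apply/matrixP => i j; rewrite !mxE; ring.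
by mx_expand; apply/matrixP => i j; rewrite !mxE; ring.
Qed.

(** In [D = ke diag(ka I, ku W) + Gamma Kk Gamma^T] the second summand sends [col_mx 0 g] to
    [- ku Gamma Kk A W g], which the input term cancels. What survives is [ke ku W g] and
    [Gamma KI z]; for [g = grad Vu] this is the shaped potential force [Mtilde^-1 grad Vd]. *)
Lemma potential_matching qu (z : 'cV[R]_m) (g : 'cV[R]_s) :
  D qu *m col_mx 0 g +
  Gam qu *m (ku *: (Kk *m A qu *m W qu *m g) + KI *m z) =
  col_mx (ka *: (KI *m z))
    (W qu *m ((ke * ku) *: g - ku *: ((A qu)^T *m (KI *m z)))).
Proof.
rewrite /Mdinv /Gammamx; set w := W _; set a := A _.
rewrite mul_block_col mul_col_mx add_col_mx !mulmx0 !add0r; congr col_mx.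
  by mx_expand; apply/matrixP => i j; rewrite !mxE; ring.
by mx_expand; apply/matrixP => i j; rewrite !mxE; ring.
Qed.

(* [J] and [Ja] stand for the Jacobians of [W pu] and [A W pu]. *)
Lemma workless_forces (qu pu : 'cV[R]_s) (pa : 'cV[R]_m) (J : 'M[R]_s)
    (Ja : 'M[R]_(m, s)) (p := col_mx pa pu) (w := W qu) (a := A qu) :
  p^T *m (D qu *m col_mx 0 (J^T *m pu)) +
  p^T *m Gam qu *m
    (ku *: (Kk *m a *m w *m J^T) - (2 * ku) *: (Kk *m Ja *m w)) *m pu =
  p^T *m col_mx 0 (w *m
    ((- (2 * ka * ku)) *: (Ja^T *m Kk *m pa) + (ke * ku) *: (J^T *m pu)
     + (2 * ku ^+ 2) *: (Ja^T *m Kk *m (a *m w *m pu)))).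
Proof.
rewrite {}/p /Mdinv /Gammamx -/w -/a.
have tr11 (x : 'M[R]_1) : x^T = x by apply/matrixP => i j; rewrite !ord1 mxE.
have sw : w^T = w by exact: W_sym.
have sk : Kk^T = Kk by exact: Kk_sym.
(* The terms in [J] cancel as in [potential_matching]. The terms in [Ja] match only up to
   transposition, and both sides are 1 by 1 matrices, hence equal to their transposes. *)
have T1 : pu^T *m w *m Ja^T *m Kk *m pa = pa^T *m Kk *m Ja *m w *m pu.
  by rewrite -[LHS]tr11 !trmx_mul !trmxK sw sk !mulmxA.
have T2 : pu^T *m w *m Ja^T *m Kk *m a *m w *m pu =
    pu^T *m w *m a^T *m Kk *m Ja *m w *m pu.
  by rewrite -[LHS]tr11 !trmx_mul !trmxK sw sk !mulmxA.
rewrite tr_col_mx mul_block_col !mul_row_col !mulmx0 !add0r.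
mx_expand; rewrite T1 T2.
by apply/matrixP => i j; rewrite !mxE; ring.
Qed.

(** * Gradients of the kinetic energies and of the shaped potential *)

Let D_smooth : smooth D.
Proof. rewrite /Mdinv; smooth_mx_ops. Qed.

Let AW_smooth : smooth (fun qu => A qu *m W qu).
Proof. exact: smooth_mulmx. Qed.

Let invMt_smooth : smooth (fun q : 'cV[R]_(m + s) => invmx (Mtilde muu q)).
Proof.
under eq_fun do rewrite invmx_Mtilde.
have := smooth_dsub m W_smooth => Wd_smooth; smooth_mx_ops.
Qed.

Lemma grad_kinetic (q p : 'cV[R]_(m + s)) :
  (jac (fun q => invmx (Mtilde muu q) *m p) q)^T *m p =
  col_mx 0 ((Jv muu (dsubmx q) (dsubmx p))^T *m dsubmx p).
Proof.
rewrite -grad_quadf_mx // -(grad_quadf_mx (F := fun y => W y)) //.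
(* The actuated block of [Mtilde] is the identity, so [pa] contributes a constant and the form
   depends on [q] through [qu] only. *)
pose c := quadf 1%:M (usubmx p).
pose f y := c + quadf (W y) (dsubmx p).
have sW : smooth (fun y => quadf (W y) (dsubmx p)).
  by rewrite /quadf; apply: smooth_coord; smooth_mx_ops.
have sc := smooth_cst 'cV[R]_s c.
rewrite (_ : (fun y => quadf (invmx _) p) = fun q => f (dsubmx q)); last first.
  apply/funext => y; rewrite invmx_Mtilde /f /c /quadf -{1 2}(vsubmxK p).
  rewrite tr_col_mx mul_row_block !mulmx0 addr0 add0r mul_row_col mxE.
  by [].
rewrite grad_dsub; last exact: smoothD.
rewrite /f gradD //.
rewrite (_ : grad (fun=> c) _ = 0) ?add0r //.
by apply/colP => i; rewrite !mxE derive_cst.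
Qed.

(** In blocks, the form of [D] is a constant in [q], minus [2 ka ku] times the pairing of [Kk pa]
    with [A W pu], plus [ke ku] times the form of [W] at [pu], plus [ku^2] times the form of [Kk] at
    [A W pu]. Differentiating these pieces brings in just [Jv] and [Jav]. *)
Lemma grad_shaped_kinetic (q p : 'cV[R]_(m + s)) (qu := dsubmx q)
    (pa := usubmx p) (pu := dsubmx p) :
  (jac (fun q => D (dsubmx q) *m p) q)^T *m p =
  col_mx 0 ((- (2 * ka * ku)) *: ((Jav muu mau qu pu)^T *m Kk *m pa)
     + (ke * ku) *: ((Jv muu qu pu)^T *m pu)
     + (2 * ku ^+ 2) *:
         ((Jav muu mau qu pu)^T *m Kk *m (A qu *m W qu *m pu))).
Proof.
have sDd : smooth (fun q : 'cV[R]_(m + s) => D (dsubmx q)).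
  exact: (smooth_dsub m D_smooth).
rewrite -grad_quadf_mx //.
have sAWp : smooth (fun y => A y *m W y *m pu) by smooth_mx_ops.
have sWp : smooth (fun y => W y *m pu) by smooth_mx_ops.
pose c := quadf ((ke * ka)%:M + ka ^+ 2 *: Kk) pa.
pose f0 (y : 'cV[R]_s) := c.
pose f1 y := ((Kk *m pa)^T *m (A y *m W y *m pu)) 0 0.
pose f2 y := quadf (W y) pu.
pose f3 y := quadf Kk (A y *m W y *m pu).
have s0 : smooth f0 by exact: smooth_cst.
have s1 : smooth f1 by apply: smooth_coord; smooth_mx_ops.
have s2 : smooth f2 by apply: smooth_coord; smooth_mx_ops.
have s3 : smooth f3 by apply: smooth_coord; smooth_mx_ops.
pose f y := f0 y +
  ((- (2 * ka * ku)) * f1 y + ((ke * ku) * f2 y + ku ^+ 2 * f3 y)).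
rewrite (_ : (fun y => quadf _ p) = fun q => f (dsubmx q)); last first.
  apply/funext => y; rewrite /f /f0 /f1 /f2 /f3 /c /quadf -{1 2}(vsubmxK p).
  rewrite -/pa -/pu /Mdinv; set w := W _; set a := A _.
  have tr11 (x : 'M[R]_1) : x^T = x by apply/matrixP => i j; rewrite !ord1 mxE.
  have sw : w^T = w by exact: W_sym.
  have sk : Kk^T = Kk by exact: Kk_sym.
  rewrite tr_col_mx mul_row_block mul_row_col !trmx_mul sk sw.
  mx_expand.
  (* The two off-diagonal blocks give transposed scalars; merging them produces the factor 2 in
     [f]. *)
  rewrite (_ : pu^T *m w *m a^T *m Kk *m pa =
      pa^T *m Kk *m a *m w *m pu); last first.
    by rewrite -[LHS]tr11 !trmx_mul !trmxK sw sk !mulmxA.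
  rewrite !mxE; ring.
have s23 : smooth (fun y => (ke * ku) * f2 y + ku ^+ 2 * f3 y).
  by apply: smoothD; exact: smoothZ.
have s123 : smooth (fun y => (- (2 * ka * ku)) * f1 y +
    ((ke * ku) * f2 y + ku ^+ 2 * f3 y)).
  by apply: smoothD => //; exact: smoothZ.
rewrite grad_dsub; last exact: smoothD.
congr col_mx; rewrite /f !gradD ?gradZ //; try exact: smoothZ.
rewrite /f1 grad_dotl // /f2 grad_quadf_mx // /f3 grad_quadf //.
rewrite (_ : grad f0 _ = 0); last by apply/colP => i; rewrite !mxE derive_cst.
by rewrite add0r addrA scalerA mulmxA [ku ^+ 2 * 2]mulrC.
Qed.

Lemma grad_Vdes (q : 'cV[R]_(m + s)) (qu := dsubmx q)
    (z := ka *: usubmx q + ku *: VN qu) :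
  grad (Vdes Vu VN ke ka ku KI) q =
  col_mx (ka *: (KI *m z))
    ((ke * ku) *: grad Vu qu - ku *: ((A qu)^T *m (KI *m z))).
Proof.
(* The scalars are written as scalar matrices so that [jac_mulmxl] differentiates both summands. *)
pose g (q : 'cV[R]_(m + s)) := ka%:M *m usubmx q + ku%:M *m VN (dsubmx q).
have su := @smooth_usubmx R m s.
have sVd : smooth (fun q : 'cV[R]_(m + s) => VN (dsubmx q)).
  exact: smooth_dsub.
have sg : smooth g by rewrite /g; smooth_mx_ops.
rewrite (_ : Vdes _ _ _ _ _ _ = fun q =>
    ke * ku * Vu (dsubmx q) + 2^-1 * quadf KI (g q)); last first.
  by apply/funext => y; rewrite /g !mul_scalar_mx.
have sVu : smooth (fun q : 'cV[R]_(m + s) => Vu (dsubmx q)).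
  exact: smooth_dsub.
have sq : smooth (fun q => quadf KI (g q)).
  by apply: smooth_coord; smooth_mx_ops.
rewrite gradD ?gradZ //; try exact: smoothZ.
rewrite grad_dsub // grad_quadf // scalerA mulVf ?scale1r ?pnatr_eq0 //.
rewrite jacD; [|by smooth_mx_ops..].
(* Integrability of the rows of [mau] enters here: the Jacobian of [z] becomes
   [[ka I | - ku mau]]. *)
rewrite !jac_mulmxl // jac_usubmx jac_dsub // jac_VN.
rewrite !mul_mx_row add_row_mx !mulmx0 addr0 add0r mulmx1 tr_row_mx.
rewrite -mulmxA mul_col_mx scale_col_mx add_col_mx scaler0 add0r.
rewrite tr_scalar_mx /g !mul_scalar_mx -/qu -/z.
by rewrite scalerN linearN linearZ /= mulNmx -scalemxAl.
Qed.

(* The row block that follows K^-1 in Lambda. *)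
Definition gyroscopic_row (qu pu : 'cV[R]_s) : 'M[R]_(m, m + s) :=
  row_mx 0 (ku *: (Kk *m A qu *m W qu *m (Jv muu qu pu)^T)
            - (2 * ku) *: (Kk *m Jav muu mau qu pu *m W qu)).

(** * The momentum equation and the dissipation inequality *)

(** Both closed-loop conditions see [Lambda] through this congruence. It strips the outer factors
    [Md], cancels [K^-1] by [D G = Gamma K], and by symmetry of [D] turns the damping into
    [(Gamma K) KP (Gamma K)^T]. *)
Lemma Mdinv_mul_Lambda (q p : 'cV[R]_(m + s)) (qu := dsubmx q) :
  D qu *m Lambda muu mau ke ka ku Kk KP q p *m D qu =
  2^-1 *: (- (D qu *m (jac (fun q => invmx (Mtilde muu q) *m p) q)^T)
    + invmx (Mtilde muu q) *m (jac (fun q => D (dsubmx q) *m p) q)^T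
    - Gam qu *m gyroscopic_row qu (dsubmx p))
  - Gam qu *m K qu *m KP *m ((K qu)^T *m (Gam qu)^T).
Proof.
rewrite /Lambda -/qu -/(gyroscopic_row qu (dsubmx p)) /Mdes -/qu.
have DG : D qu *m Gtilde mau q = Gam qu *m K qu by exact: Mdinv_mul_Gtilde.
have GD : (Gtilde mau q)^T *m D qu = (K qu)^T *m (Gam qu)^T.
  by rewrite -{1}(D_sym qu) -trmx_mul DG trmx_mul.
rewrite DG mulmxK // mulmxBr mulmxBl -scalemxAr -scalemxAl.
congr (_ *: _ - _); first by rewrite !mulmxA mulmxV // mul1mx mulmxKV.
by rewrite !mulmxA DG -[LHS]mulmxA GD !mulmxA.
Qed.

Let Vu_dsub_smooth : smooth (fun q : 'cV[R]_(m + s) => Vu (dsubmx q)).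
Proof. exact: smooth_dsub. Qed.

Let D_dsub_smooth : smooth (fun q : 'cV[R]_(m + s) => D (dsubmx q)).
Proof. exact: (smooth_dsub m D_smooth). Qed.

Lemma smooth_Vdes : smooth (Vdes Vu VN ke ka ku KI : 'cV[R]_(m + s) -> R).
Proof.
have su := @smooth_usubmx R m s.
have sVd : smooth (fun q : 'cV[R]_(m + s) => VN (dsubmx q)).
  exact: smooth_dsub.
apply: smoothD; first exact: smoothZ.
apply: (smoothZ 2^-1); apply: smooth_coord; smooth_mx_ops.
Qed.

Lemma smooth_Mdes : smooth (Mdes muu mau ke ka ku Kk : 'cV[R]_(m + s) -> _).
Proof. by apply: smooth_invmx. Qed.

(** The coefficients [ku / 2] and [ku] of the velocity terms in the control law are half of those in
    [gyroscopic_row], which agrees with the overall factor one half in [Lambda]. *)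
Lemma Kmx_mul_control (q p : 'cV[R]_(m + s)) (qu := dsubmx q)
    (z := ka *: usubmx q + ku *: VN qu) :
  K qu *m control muu mau Vu VN ke ka ku Kk KI KP q p =
  - (ku *: (Kk *m A qu *m W qu *m grad Vu qu) + KI *m z
     + 2^-1 *: (gyroscopic_row qu (dsubmx p) *m p))
  - K qu *m (KP *m ((K qu)^T *m ((Gam qu)^T *m p))).
Proof.
rewrite tr_Gammamx_mul /symmx // /control -/qu -/z.
rewrite mulmxBr mulmxN mulKVmx // -!(mulmxA KP).
congr (- _ - _); rewrite -!addrA; congr (_ + (_ + _)).
rewrite -[in RHS](vsubmxK p) mul_row_col mul0mx add0r col_mxKd.
mx_expand.
by apply/matrixP => i j; rewrite !mxE; field.
Qed.

Lemma SIDA_momentum_equation (q p : 'cV[R]_(m + s)) :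
  - grad (fun q' => hamiltonian (Mtilde muu) (fun q => Vu (dsubmx q)) q' p) q
  + Gtilde mau q *m control muu mau Vu VN ke ka ku Kk KI KP q p =
  - (Mdes muu mau ke ka ku Kk q *m invmx (Mtilde muu q) *m
     grad (fun q' => hamiltonian (Mdes muu mau ke ka ku Kk)
       (Vdes Vu VN ke ka ku KI) q' p) q)
  + Lambda muu mau ke ka ku Kk KP q p *m
    invmx (Mdes muu mau ke ka ku Kk q) *m p.
Proof.
set qu := dsubmx q.
have squad (F : 'cV[R]_(m + s) -> 'M[R]_(m + s)) : smooth F ->
    smooth (fun q => quadf (F q) p).
  by move=> sF; apply: smooth_coord; smooth_mx_ops.
set z := ka *: usubmx q + ku *: VN qu; set g := grad Vu qu.
set Jt := jac (fun q => invmx (Mtilde muu q) *m p) q.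
set Jd := jac (fun q => D (dsubmx q) *m p) q.
rewrite [grad _ q](_ : _ = 2^-1 *: (Jt^T *m p) + col_mx 0 g); last first.
  rewrite gradD ?gradZ //; [|exact: squad|exact/smoothZ/squad].
  by rewrite grad_dsub // grad_quadf_mx.
rewrite [grad _ q](_ : _ = 2^-1 *: (Jd^T *m p) + col_mx (ka *: (KI *m z))
    ((ke * ku) *: g - ku *: ((A qu)^T *m (KI *m z)))); last first.
  (* [Mdes] is itself an inverse, so the shaped kinetic energy is a form in the explicit matrix
     [D]. *)
  rewrite /hamiltonian; under eq_fun do rewrite /Mdes invmxK.
  rewrite gradD ?gradZ //; [|exact: squad|exact/smoothZ/squad|].
    by rewrite grad_quadf_mx // grad_Vdes.
  exact: smooth_Vdes.
apply: (can_inj (mulKmx (D_unit qu))).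
rewrite /Mdes -/qu invmxK.
rewrite mulmxDr [in RHS]mulmxDr !mulmxN -(mulmxA (invmx _)) mulKVmx //.
rewrite [D qu *m (_ *m control _ _ _ _ _ _ _ _ _ _ _ _)]mulmxA.
rewrite Mdinv_mul_Gtilde.
rewrite -(mulmxA (Gam _)) Kmx_mul_control -/qu -/z -/g.
rewrite [D qu *m (_ *m p)]mulmxA [D qu *m (_ *m _)]mulmxA Mdinv_mul_Lambda.
rewrite -/qu -/Jt -/Jd.
(* The shaped potential force is replaced by the open-loop one plus the potential part of the input,
   after which the same terms stand on both sides. *)
have mt : invmx (Mtilde muu q) *m col_mx (ka *: (KI *m z))
    ((ke * ku) *: g - ku *: ((A qu)^T *m (KI *m z))) =
  D qu *m col_mx 0 g +
  Gam qu *m (ku *: (Kk *m A qu *m W qu *m g) + KI *m z).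
  rewrite potential_matching invmx_Mtilde mul_block_col !mul0mx mul1mx.
  by rewrite addr0 add0r.
rewrite [in RHS]mulmxDr mt.
(* The rest holds for arbitrary matrices: the [Jd] term of [Lambda] cancels the kinetic part of
   [grad Hd], while its [Jt] and [B] terms reproduce the open-loop kinetic force and the velocity
   terms of the control. *)
clearbody Jt Jd g.
move: (gyroscopic_row _ _) => B.
move: (ku *: _ + _) => N.
move: (invmx _) (Gam qu) (D qu) (K qu) => iMt Ga D' K'.
mx_expand.
by apply/matrixP => i j; rewrite !mxE; ring.
Qed.

Lemma SIDA_dissipation (q p : 'cV[R]_(m + s)) : sympos KP ->
  quadf (invmx (Mdes muu mau ke ka ku Kk q) *m
    Lambda muu mau ke ka ku Kk KP q p *m
    invmx (Mdes muu mau ke ka ku Kk q)) p <= 0.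
Proof.
move=> posKP; rewrite /Mdes invmxK /quadf Mdinv_mul_Lambda.
set qu := dsubmx q; set Jt := jac _ q; set Jd := jac _ q.
set B := gyroscopic_row _ _; set Ga := Gam _.
have -> : p^T *m (2^-1 *: (- (D qu *m Jt^T) + invmx (Mtilde muu q) *m Jd^T
      - Ga *m B) - Ga *m K qu *m KP *m ((K qu)^T *m Ga^T)) *m p =
    - (((K qu)^T *m (Ga^T *m p))^T *m KP *m ((K qu)^T *m (Ga^T *m p))).
  (* Regrouping isolates, next to the damping form, the power of the forces in the bracket of
     [Lambda]. *)
  have -> : p^T *m (2^-1 *: (- (D qu *m Jt^T) + invmx (Mtilde muu q) *m Jd^T
      - Ga *m B) - Ga *m K qu *m KP *m ((K qu)^T *m Ga^T)) *m p =
    2^-1 *: (p^T *m (invmx (Mtilde muu q) *m (Jd^T *m p))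
      - (p^T *m (D qu *m (Jt^T *m p)) + p^T *m Ga *m (B *m p)))
    - p^T *m Ga *m K qu *m KP *m ((K qu)^T *m Ga^T *m p).
    clearbody Jt Jd B Ga; move: (invmx _) (D qu) (K qu) => iMt D' K'.
    mx_expand.
    by apply/matrixP => i j; rewrite !mxE; ring.
  rewrite grad_shaped_kinetic grad_kinetic.
  rewrite invmx_Mtilde mul_block_col !mul0mx mulmx0 !add0r.
  (* Once the Jacobians are evaluated, the bracket is the difference of the two sides of
     [workless_forces] and vanishes. *)
  have := workless_forces qu (dsubmx p) (usubmx p) (Jv muu qu (dsubmx p))
    (Jav muu mau qu (dsubmx p)).
  rewrite vsubmxK -/Ga => <-.
  rewrite [B *m p](_ : _ =
      (ku *: (Kk *m A qu *m W qu *m (Jv muu qu (dsubmx p))^T)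
       - (2 * ku) *: (Kk *m Jav muu mau qu (dsubmx p) *m W qu)) *m dsubmx p).
    by rewrite !mulmxA subrr scaler0 add0r !trmx_mul !trmxK !mulmxA.
  by rewrite -[in LHS](vsubmxK p) mul_row_col mul0mx add0r.
by rewrite mxE oppr_le0; exact: quadf_ge0.
Qed.

(** * Joint smoothness of the control law and of [Lambda] in [(q, p)] *)

Let phase_fst_continuous :
  continuous (fst : 'cV[R]_(m + s) * 'cV[R]_(m + s) -> 'cV[R]_(m + s)).
Proof. by move=> x; exact: cvg_fst. Qed.

Let phase_smooth_fst (U : normedModType R) (f : 'cV[R]_(m + s) -> U) :
  smooth f -> smooth (fun x : 'cV[R]_(m + s) * 'cV[R]_(m + s) => f x.1).
Proof. exact/smooth_comp_linear/phase_fst_continuous. Qed.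

Let phase_smooth_dsub (U : normedModType R) (f : 'cV[R]_s -> U) :
  smooth f ->
  smooth (fun x : 'cV[R]_(m + s) * 'cV[R]_(m + s) => f (dsubmx x.1)).
Proof. by move=> sf; exact: (phase_smooth_fst (smooth_dsub m sf)). Qed.

Let pu_smooth :
  smooth (fun x : 'cV[R]_(m + s) * 'cV[R]_(m + s) => dsubmx x.2).
Proof.
exact: (smooth_linear_comp (@dsubmx_continuous R m s 1) (@smooth_snd R _ _)).
Qed.

Let pa_smooth :
  smooth (fun x : 'cV[R]_(m + s) * 'cV[R]_(m + s) => usubmx x.2).
Proof.
exact: (smooth_linear_comp (@usubmx_continuous R m s 1) (@smooth_snd R _ _)).
Qed.

Let phase_smooth_jac k (F : 'cV[R]_s -> 'M[R]_(k, s)) : smooth F ->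
  smooth (fun x : 'cV[R]_(m + s) * 'cV[R]_(m + s) =>
    jac (fun y => F y *m dsubmx x.2) (dsubmx x.1)).
Proof.
move=> sF; apply: (smooth_jac (L := dsubmx \o fst)) => // x.
apply: continuous_comp; first exact: phase_fst_continuous.
exact: dsubmx_continuous.
Qed.

Let Jv_smooth : smooth (fun x : 'cV[R]_(m + s) * 'cV[R]_(m + s) =>
  Jv muu (dsubmx x.1) (dsubmx x.2)).
Proof. exact: phase_smooth_jac. Qed.

Let Jav_smooth : smooth (fun x : 'cV[R]_(m + s) * 'cV[R]_(m + s) =>
  Jav muu mau (dsubmx x.1) (dsubmx x.2)).
Proof. exact: phase_smooth_jac. Qed.

Let K_smooth : smooth K.
Proof. rewrite /Kmx; smooth_mx_ops. Qed.

Lemma smooth_control :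
  smooth (fun x : 'cV[R]_(m + s) * 'cV[R]_(m + s) =>
    control muu mau Vu VN ke ka ku Kk KI KP x.1 x.2).
Proof.
have sA := phase_smooth_dsub mau_smooth.
have sW := phase_smooth_dsub W_smooth.
have sK := phase_smooth_dsub K_smooth.
have sKi := phase_smooth_dsub (smooth_invmx K_unit K_smooth).
have sg := phase_smooth_dsub (smooth_grad Vu_smooth).
have sN := phase_smooth_dsub VN_smooth.
have sqa := phase_smooth_fst (@smooth_usubmx R m s).
rewrite /control; smooth_mx_ops.
Qed.

Lemma smooth_Lambda :
  smooth (fun x : 'cV[R]_(m + s) * 'cV[R]_(m + s) =>
    Lambda muu mau ke ka ku Kk KP x.1 x.2).
Proof.
have sA := phase_smooth_dsub mau_smooth.
have sW := phase_smooth_dsub W_smooth.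
have sKi := phase_smooth_dsub (smooth_invmx K_unit K_smooth).
have sD := phase_smooth_dsub D_smooth.
have sMd := phase_smooth_fst smooth_Mdes.
have sMt := phase_smooth_fst invMt_smooth.
have sp := @smooth_snd R 'cV[R]_(m + s) 'cV[R]_(m + s).
have sJt := smooth_jac phase_fst_continuous invMt_smooth sp.
have sJd := smooth_jac phase_fst_continuous D_dsub_smooth sp.
rewrite /Lambda /Gtilde; smooth_mx_ops.
Qed.

End Closed_loop.

Theorem proposition3 (R : realType) (m s : nat)
    (hm : (1 <= m)%N) (hs : (1 <= s)%N)
    (muu : 'cV[R]_s -> 'M[R]_s) (mau : 'cV[R]_s -> 'M[R]_(m, s))
    (Vu : 'cV[R]_s -> R) (VN : 'cV[R]_s -> 'cV[R]_m)
    (muu_smooth : smooth muu) (mau_smooth : smooth mau)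
    (Vu_smooth : smooth Vu) (VN_smooth : smooth VN)
    (muu_sympos : forall qu, sympos (muu qu))
    (qstar : 'cV[R]_(m + s))
    (A5 : rows_jacobian_symmetric mau)
    (A5_VN : forall qu, jac VN qu = - mau qu)
    (ke ka ku : R) (Kk KI : 'M[R]_m)
    (Kk_sympossemi : sympossemi Kk) (KI_sympossemi : sympossemi KI)
    (A6a : forall qu, Kmx muu mau ke ka ku Kk qu \in unitmx)
    (A6b_Md : forall qu, sympos (Mdinv muu mau ke ka ku Kk qu))
    (A6b_argmin : is_argmin (Vdes Vu VN ke ka ku KI) qstar)
    (A6b_isolated : is_isolated_min (Vdes Vu VN ke ka ku KI) qstar)
    (KP : 'M[R]_m) (KP_sympos : sympos KP) :
  is_SIDA_PBC (pfl_system muu mau Vu) qstar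
    (control muu mau Vu VN ke ka ku Kk KI KP)
    (Mdes muu mau ke ka ku Kk)
    (Vdes Vu VN ke ka ku KI)
    (Lambda muu mau ke ka ku Kk KP).
Proof.
split.
- split.
  + exact: smooth_control.
  + exact: smooth_Mdes.
  + exact: smooth_Vdes.
  + exact: smooth_Lambda.
- by move=> q; exact/sympos_invmx.
- exact: A6b_argmin.
- move=> q p; apply: SIDA_momentum_equation => //.
  exact: KI_sympossemi.1.
- move=> q p; apply: SIDA_dissipation => //.
  exact: Kk_sympossemi.1.
Qed.
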